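(* Let $p,r\ge 0$ be integers, $d=p+2r$, and $\Lambda=\{\lambda_1,\dots,\lambda_r\}\subset\mathbb{C}$, where the $2r$ numbers $\pm\lambda_1,\dots,\pm\lambda_r$ are nonzero and pairwise distinct. For each $n\ge 0$ let $\widetilde{\boldsymbol{B}}^{[n]}=(\widetilde{\boldsymbol{B}}^{[n]}_k)_{k\in\mathbb{Z}}$ be a finitely supported sequence of $(d+1)\times(d+1)$ matrices. Then $\widetilde{\boldsymbol{B}}^{[n]}$ satisfies the $V_{p,\Lambda}$-vanishing moment condition, i.e. $$\sum_{j\in\mathbb{Z}}(\widetilde{\boldsymbol{B}}^{[n]}_{j-2k})^T\,\boldsymbol{v}^{[n+1]}_{f;j}=0\qquad\text{for all } f\in V_{p,\Lambda},\ k\in\mathbb{Z},\ n\ge 0,$$ if and only if for every $n\ge 0$ there exists a finitely supported sequence $\boldsymbol{S}^{[n]}$ of $(d+1)\times(d+1)$ matrices such that $$(\widetilde{\boldsymbol{B}}^{[n]})^{\sharp}(z)=\boldsymbol{S}^{[n]}(z)\,\boldsymbol{H}^{[n+1]}_{p,\Lambda}(z).$$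
   Context: All matrices and vectors may have complex entries. Function space: $V_{p,\Lambda}=\operatorname{span}\{1,x,\dots,x^p,e^{\pm\lambda_1x},\dots,e^{\pm\lambda_rx}\}$ (dimension $d+1$). Sampled vector sequences: for $f\in C^d(\mathbb{R})$, $n\ge 0$, $k\in\mathbb{Z}$, $$\boldsymbol{v}^{[n]}_{f;k}=\big[f(2^{-n}k),\,2^{-n}f'(2^{-n}k),\,\dots,\,2^{-nd}f^{(d)}(2^{-n}k)\big]^T.$$ Symbols: a finitely supported matrix sequence $\boldsymbol{M}=(\boldsymbol{M}_k)_{k\in\mathbb{Z}}$ has as symbol the matrix Laurent polynomial $\boldsymbol{M}(z)=\sum_k\boldsymbol{M}_kz^k$, and $\boldsymbol{M}^\sharp(z):=\boldsymbol{M}(z^{-1})^T=\sum_k \boldsymbol{M}_k^Tz^{-k}$. Cancellation operator: for a frequency set $\Lambda$ as in the claim, $\boldsymbol{H}^*_{p,\Lambda}(z)$ denotes the unique $(d+1)\times(d+1)$ matrix Laurent polynomial of the form $z^{-1}\boldsymbol{I}+\boldsymbol{H}_0$ ($\boldsymbol{H}_0$ a constant matrix) with block structure $$\boldsymbol{H}^*_{p,\Lambda}(z)=\begin{bmatrix}\boldsymbol{T}_p(z)&\ast\\0&\ast\end{bmatrix},$$ where $\boldsymbol{T}_p(z)$ is the $(p+1)\times(p+1)$ upper triangular matrix with diagonal entries $z^{-1}-1$ and $(i,j)$ entry $-\frac{1}{(j-i)!}$ for $j>i$, and satisfying $$\boldsymbol{H}^*_{p,\Lambda}(e^{\mp\lambda})\,[1,\pm\lambda,\dots,(\pm\lambda)^d]^T=0\quad\text{for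 all }\lambda\in\Lambda.$$ The symbol of the level-$n$ cancellation operator is $\boldsymbol{H}^{[n]}_{p,\Lambda}(z):=\boldsymbol{H}^*_{p,2^{-n}\Lambda}(z)$, where $2^{-n}\Lambda=\{2^{-n}\lambda:\lambda\in\Lambda\}$; writing $\boldsymbol{H}^{[n]}_{p,\Lambda}(z)=\sum_k \boldsymbol{H}^{[n]}_{p,\Lambda;k}z^k$, it satisfies $\sum_k\boldsymbol{H}^{[n]}_{p,\Lambda;j-k}\boldsymbol{v}^{[n]}_{f;k}=0$ for all $j\in\mathbb{Z}$ and $f\in V_{p,\Lambda}$. *)

(* Defs.v *)
From HB Require Import structures.
From mathcomp Require Import all_boot all_order all_algebra complex.
From mathcomp Require Import all_classical all_reals all_analysis.
Set Implicit Arguments.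
Unset Strict Implicit.
Unset Printing Implicit Defensive.
Import Order.TTheory GRing.Theory Num.Theory.
Import numFieldNormedType.Exports.
Local Open Scope classical_set_scope.
Local Open Scope ring_scope.
Local Open Scope complex_scope.

Definition cexp (R : realType) (z : R[i]) : R[i] :=
  (expR (complex.Re z) * cos (complex.Im z)) +i*
  (expR (complex.Re z) * sin (complex.Im z)).

(* m-th derivative of a complex-valued function of a real variable. *)
Definition cderiv (R : realType) (m : nat) (f : R -> R[i]) (x : R) : R[i] :=
  (derive1n m (fun t => complex.Re (f t)) x) +i*
  (derive1n m (fun t => complex.Im (f t)) x).

(* The 2r numbers +-lambda_i, indexed by a sign and an index. *)
Definition sfreq (R : realType) (r : nat) (lam : 'I_r -> R[i])
  (si : bool * 'I_r) : R[i] := (-1) ^+ si.1 * lam si.2.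

(* V_{p,Lambda}, the complex span of 1, x, ..., x^p, e^{+-lambda_i x}, as
   functions on the real line. *)
Definition Vspace (R : realType) (p r : nat) (lam : 'I_r -> R[i])
  : set (R -> R[i]) :=
  [set f | exists (a : 'I_p.+1 -> R[i]) (b : bool * 'I_r -> R[i]),
     forall x : R, f x = \sum_(j < p.+1) a j * (x ^+ j)%:C
                       + \sum_si b si * cexp (sfreq lam si * x%:C)].

Definition sample (R : realType) (D : nat) (f : R -> R[i]) (n : nat) (k : int)
  : 'cV[R[i]]_D :=
  \col_(m < D) (((2 ^- n) ^+ m)%:C * cderiv m f (2 ^- n * k%:~R)).

Definition finitely_supported (R : realType) (D : nat) (M : int -> 'M[R[i]]_D) :=
  finite_set [set k | M k != 0].

(* A matrix Laurent polynomial is identified with the function it induces on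
   nonzero complex numbers. *)
Definition symbol (R : realType) (D : nat) (M : int -> 'M[R[i]]_D) (z : R[i])
  : 'M[R[i]]_D := \sum_(k \in [set: int]) z ^ k *: M k.

Definition sharp (R : realType) (D : nat) (M : int -> 'M[R[i]]_D) (z : R[i])
  : 'M[R[i]]_D := (symbol M z^-1)^T.

(* Matrices have size d + 1 with d = p + 2r, written p.+1 + 2 * r (convertible
   to (p + 2 * r).+1) so that the block decomposition is available. *)

Definition Tmx (R : realType) (p : nat) (z : R[i]) : 'M[R[i]]_p.+1 :=
  \matrix_(i, j) if i == j then z^-1 - 1
                 else if (i < j)%N then - ((j - i)`!%:R)^-1 else 0.

Definition pencil (R : realType) (D : nat) (H0 : 'M[R[i]]_D) (z : R[i])
  : 'M[R[i]]_D := z^-1%:M + H0.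

Definition freqvec (R : realType) (D : nat) (mu : R[i]) : 'cV[R[i]]_D :=
  \col_(m < D) mu ^+ m.

(* z^-1 I + H0 has the block structure and annihilation property that
   characterize the cancellation operator. *)
Definition is_cancellation (R : realType) (p r : nat) (lam : 'I_r -> R[i])
  (H0 : 'M[R[i]]_(p.+1 + 2 * r)) : Prop :=
  (forall z : R[i], z != 0 ->
     ulsubmx (pencil H0 z) = Tmx p z /\ dlsubmx (pencil H0 z) = 0) /\
  (forall si : bool * 'I_r,
     pencil H0 (cexp (- sfreq lam si)) *m freqvec _ (sfreq lam si) = 0).

(* Frequencies for which +-lambda_i are nonzero and pairwise distinct. *)
Definition admissible (R : realType) (r : nat) (lam : 'I_r -> R[i]) : Prop :=
  (forall si, sfreq lam si != 0) /\ injective (sfreq lam).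

(* H^*_{p,Lambda}; the constant matrix is well defined for admissible
   frequencies by is_cancellation_unique below. *)
Definition Hstar (R : realType) (p r : nat) (lam : 'I_r -> R[i]) (z : R[i])
  : 'M[R[i]]_(p.+1 + 2 * r) :=
  pencil (xget 0 [set H0 | is_cancellation lam H0]) z.

Definition Hlevel (R : realType) (p r : nat) (lam : 'I_r -> R[i]) (n : nat)
  : R[i] -> 'M[R[i]]_(p.+1 + 2 * r) :=
  Hstar p (fun i => (2 ^- n)%:C * lam i).

Lemma is_cancellation_unique (R : realType) (p r : nat) (lam : 'I_r -> R[i]) :
  admissible lam ->
  exists! H0 : 'M[R[i]]_(p.+1 + 2 * r), is_cancellation lam H0.
Proof.
move=> [lam0 laminj].
have cE : #|{: bool * 'I_r}| = (2 * r)%N by rewrite card_prod card_bool card_ord.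
pose si (i : 'I_(2 * r)) : bool * 'I_r := enum_val (cast_ord (esym cE) i).
have si_surj s : exists i, si i = s.
  by exists (cast_ord cE (enum_rank s)); rewrite /si cast_ordK enum_rankK.
have si_inj : injective si.
  by move=> i j /enum_val_inj /cast_ord_inj.
pose mu i := sfreq lam (si i).
pose Wt : 'M[R[i]]_(p.+1 + 2 * r, 2 * r) := \matrix_(m, i) mu i ^+ m.
pose E : 'M[R[i]]_(2 * r) := diag_mx (\row_i (cexp (- mu i))^-1).
pose A : 'M[R[i]]_(p.+1 + 2 * r, p.+1) := col_mx (Tmx p 1 - 1%:M) 0.
have WdE : dsubmx Wt = Vandermonde (2 * r) (\row_i mu i)
                        *m diag_mx (\row_i mu i ^+ p.+1).
  apply/matrixP => m i; rewrite mul_mx_diag !mxE -exprD /=.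
  by rewrite addnC.
have Wd : dsubmx Wt \in unitmx.
  rewrite WdE unitmx_mul !unitmxE !unitfE det_Vandermonde det_diag.
  apply/andP; split; apply/prodf_neq0 => i _; last first.
    by rewrite mxE expf_neq0 ?lam0.
  apply/prodf_neq0 => j ij; rewrite !mxE subr_eq0.
  apply/eqP => /laminj /si_inj ji; by rewrite ji ltnn in ij.
have charE (H0 : 'M[R[i]]_(p.+1 + 2 * r)) : is_cancellation lam H0 <->
    lsubmx H0 = A /\ H0 *m Wt = - (Wt *m E).
  have TE z : Tmx p z = z^-1%:M + (Tmx p 1 - 1%:M) :> 'M[R[i]]_p.+1.
    apply/matrixP => i j; rewrite !mxE.
    case: eqP => _ /=; last by rewrite !mulr0n subr0 add0r.
    by rewrite !mulr1n invr1 subrr sub0r.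
  have scE z : z%:M = block_mx z%:M 0 0 z%:M :> 'M[R[i]]_(p.+1 + 2 * r).
    exact: scalar_mx_block.
  have blk z : ulsubmx (pencil H0 z) = Tmx p z /\ dlsubmx (pencil H0 z) = 0 <->
      lsubmx H0 = A.
    rewrite /pencil -{1 2}[H0]submxK scE add_block_mx block_mxKul block_mxKdl.
    rewrite TE add0r; split.
      case=> /addrI ul dl; rewrite -[H0]submxK ul dl.
      by rewrite block_mxEh row_mxKl.
    move=> lE; rewrite -[H0]hsubmxK lE -[rsubmx H0]vsubmxK -block_mxEh.
    by rewrite block_mxKul block_mxKdl.
  have colE : (forall s, pencil H0 (cexp (- sfreq lam s))
      *m freqvec _ (sfreq lam s) = 0) <-> H0 *m Wt = - (Wt *m E).
    have cj i : col i (H0 *m Wt + Wt *m E) =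
       pencil H0 (cexp (- mu i)) *m freqvec _ (mu i).
      rewrite /pencil mulmxDl mul_scalar_mx [RHS]addrC.
      apply/matrixP => a b; rewrite !mxE; congr (_ + _).
        by apply: eq_bigr => k _; rewrite !mxE.
      have := mul_mx_diag Wt (\row_i (cexp (- mu i))^-1).
      by move=> /matrixP/(_ a i); rewrite !mxE => ->; rewrite mulrC.
    split=> [h|h s].
      apply/eqP; rewrite -addr_eq0; apply/eqP/matrixP => a i.
      by have /matrixP/(_ a 0) := cj i; rewrite h [in LHS]mxE => ->; rewrite !mxE.
    have [i <-] := si_surj s.
    by rewrite -cj h addNr; apply/matrixP => a b; rewrite !mxE.
  split=> [[h1 h2]|[h1 h2]].
    by split; [apply/(blk 1)/h1; exact: oner_neq0|apply/colE].
  by split; [move=> z _; apply/blk|apply/colE].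
have mulE (H0 : 'M[R[i]]_(p.+1 + 2 * r)) : H0 *m Wt =
    lsubmx H0 *m usubmx Wt + rsubmx H0 *m dsubmx Wt.
  by rewrite -mul_row_col hsubmxK vsubmxK.
pose B := (- (Wt *m E) - A *m usubmx Wt) *m invmx (dsubmx Wt).
exists (row_mx A B); split.
  apply/charE; rewrite mulE row_mxKl row_mxKr /B mulmxKV //.
  by split => //; rewrite addrC subrK.
move=> H0 /charE [lA]; rewrite mulE lA => h.
rewrite -[RHS]hsubmxK lA; congr row_mx.
by rewrite /B -h addrC addKr mulmxK.
Qed.

Lemma Hstar_cancellation (R : realType) (p r : nat) (lam : 'I_r -> R[i]) :
  admissible lam ->
  exists2 H0 : 'M[R[i]]_(p.+1 + 2 * r), is_cancellation lam H0 &
    forall z, Hstar p lam z = pencil H0 z.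
Proof.
move=> /(is_cancellation_unique p) [H0 [hH0 _]].
by eexists; last by []; apply: (@xgetPex _ 0 [set H | is_cancellation lam H]); exists H0.
Qed.

(* Main.v *)
(* Write w = z^-1.  By uniqueness of Laurent coefficients, the factorization
   says that sum_j (B_j)^T w^j is right divisible by the linear pencil w I + H,
   where H is the constant term of the cancellation operator.  The samples of
   every f in V satisfy v_(j+1) = - H v_j (Taylor's formula for polynomials, the
   defining property of H for exponentials), so divisibility kills the moments
   by telescoping.  Conversely, Horner's scheme divides by the pencil with a
   constant remainder, and the moments are this remainder applied to v_0; the
   vectors v_0 span the whole space, by a count of polynomial roots, so
   vanishing moments force the remainder to be 0. *)
Require Import Defs.
From mathcomp Require Import all_boot all_order all_algebra complex finmap.
From mathcomp Require Import all_classical all_reals all_analysis.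
From mathcomp Require Import zify ring.
Set Implicit Arguments.
Unset Strict Implicit.
Unset Printing Implicit Defensive.
Import Order.TTheory GRing.Theory Num.Theory.
Import numFieldNormedType.Exports.
Local Open Scope classical_set_scope.
Local Open Scope ring_scope.
Local Open Scope complex_scope.

(** * Finitely supported sums over the integers *)

(** A sum with infinite support is 0 by convention, whence the finiteness hypotheses; all sums are
    taken over the union of the two supports. *)
Lemma fsumD (V : zmodType) (I : choiceType) (F G : I -> V) :
  finite_set [set i | F i != 0] -> finite_set [set i | G i != 0] ->
  \sum_(i \in [set: I]) (F i + G i) =
  \sum_(i \in [set: I]) F i + \sum_(i \in [set: I]) G i.
Proof.
move=> finF finG; set A := fset_set ([set i | F i != 0] `|` [set i | G i != 0]).
have out i : i \notin A -> F i = 0 /\ G i = 0.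
  rewrite in_fset_set ?finite_setU// notin_setE /= => /not_orP[].
  by move=> /negP/negPn/eqP -> /negP/negPn/eqP ->.
rewrite !(@fsbigTE _ _ _ _ A) ?big_split //.
- by move=> i /out[].
- by move=> i /out[].
- by move=> i /out[-> ->]; rewrite addr0.
Qed.

Lemma raddf_fsum (U V : zmodType) (I : choiceType) (phi : {additive U -> V})
    (F : I -> U) : finite_set [set i | F i != 0] ->
  phi (\sum_(i \in [set: I]) F i) = \sum_(i \in [set: I]) phi (F i).
Proof.
move=> finF; set A := fset_set [set i | F i != 0].
have out i : i \notin A -> F i = 0.
  by rewrite in_fset_set // notin_setE /= => /negP/negPn/eqP.
rewrite !(@fsbigTE _ _ _ _ A) ?raddf_sum // => i /out -> //.
by rewrite raddf0.
Qed.

Lemma finitely_supported_sub (R : realType) (D : nat)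
    (M N : int -> 'M[R[i]]_D) :
  (forall k, N k = 0 -> M k = 0) -> finitely_supported N ->
  finitely_supported M.
Proof.
move=> NM; apply: sub_finite_set => k /=; apply: contra => /eqP /NM ->.
exact: eqxx.
Qed.

Lemma finitely_supportedD (R : realType) (D : nat)
    (M N : int -> 'M[R[i]]_D) :
  finitely_supported M -> finitely_supported N ->
  finitely_supported (fun k => M k + N k).
Proof.
move=> finM finN.
have finMN : finite_set ([set k | M k != 0] `|` [set k | N k != 0]).
  by rewrite finite_setU.
apply: sub_finite_set finMN => k /= MN; apply/orP; rewrite -negb_and.
by apply: contra MN => /andP[/eqP -> /eqP ->]; rewrite addr0.
Qed.

Lemma finitely_supported_comp (R : realType) (D : nat)
    (M : int -> 'M[R[i]]_D) (h : int -> int) :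
  injective h -> finitely_supported M -> finitely_supported (M \o h).
Proof.
move=> hinj; rewrite /finitely_supported => finM.
apply: (@finite_preimage _ _ [set k | M k != 0] h) => //.
by move=> x y _ _; apply: hinj.
Qed.

Lemma finitely_supported_window (R : realType) (D : nat)
    (M : int -> 'M[R[i]]_D) : finitely_supported M ->
  exists K : nat, forall j : int, (K <= `|j|)%N -> M j = 0.
Proof.
move=> /finite_seqP[s sE]; exists (\max_(j <- s) `|j|%N).+1 => j jK.
apply/eqP; apply: contraTT jK => Mj; rewrite -ltnNge ltnS.
have js : [set` s] j by rewrite -sE.
exact: (@leq_bigmax_seq _ s predT absz j).
Qed.

Lemma window_finitely_supported (R : realType) (D K : nat)
    (M : int -> 'M[R[i]]_D) :
  (forall j : int, (K <= `|j|)%N -> M j = 0) -> finitely_supported M.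
Proof.
move=> M0; apply: (@sub_finite_set _ _ [set j : int | (`|j| < K)%N]).
  by move=> j /=; apply: contraNltn => /M0 ->.
apply: (@sub_finite_set _ _ [set` [seq i%:Z - K%:Z | i <- iota 0 (K + K)]]).
  move=> j /= jK; apply/mapP; exists (absz (j + K%:Z)); last by lia.
  by rewrite mem_iota; lia.
exact: finite_seq.
Qed.

(** * Moments and summation by parts *)

(* With u_j = w^j I this is a symbol evaluated at w; with u_j a shifted sample
   sequence it is a left-hand side of the moment condition. *)
Definition moment (R : realType) (D m : nat) (M : int -> 'M[R[i]]_D)
    (u : int -> 'M[R[i]]_(D, m)) : 'M[R[i]]_(D, m) :=
  \sum_(j \in [set: int]) M j *m u j.

Lemma finite_moment (R : realType) (D m : nat) (M : int -> 'M[R[i]]_D)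
    (u : int -> 'M[R[i]]_(D, m)) :
  finitely_supported M -> finite_set [set j | M j *m u j != 0].
Proof.
apply: sub_finite_set => j /=; apply: contra => /eqP ->.
by rewrite mul0mx.
Qed.

Lemma moment_shift (R : realType) (D m : nat) (c : int)
    (M : int -> 'M[R[i]]_D) (u : int -> 'M[R[i]]_(D, m)) :
  moment (fun j => M (j - c)) u = moment M (fun j => u (j + c)).
Proof.
rewrite /moment (reindex_fsbigT (fun j : int => j + c)); last first.
  by exists (fun j => j - c) => j; rewrite ?addrK ?subrK.
by apply: eq_fsbigr => j _; rewrite addrK.
Qed.

Lemma momentD (R : realType) (D m : nat) (M N : int -> 'M[R[i]]_D)
    (u : int -> 'M[R[i]]_(D, m)) :
  finitely_supported M -> finitely_supported N ->
  moment (fun j => M j + N j) u = moment M u + moment N u.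
Proof.
move=> finM finN; rewrite /moment -fsumD; [|exact: finite_moment..].
by apply: eq_fsbigr => j _; rewrite mulmxDl.
Qed.

(** Summation by parts: the shift passes from [T] to [u]. It serves both for sample sequences and
    for the powers of w. *)
Lemma moment_factor (R : realType) (D m : nat) (H : 'M[R[i]]_D)
    (P T : int -> 'M[R[i]]_D) (u : int -> 'M[R[i]]_(D, m)) :
  finitely_supported T -> (forall j, P j = T (j - 1) + T j *m H) ->
  moment P u = moment T (fun j => u (j + 1) + H *m u j).
Proof.
move=> finT PE.
have finT1 : finitely_supported (fun j => T (j - 1)).
  apply: (finitely_supported_comp (h := fun j : int => j - 1)) finT.
  exact: addIr.
have finTH : finitely_supported (fun j => T j *m H).
  by apply: finitely_supported_sub finT => k ->; rewrite mul0mx.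
have -> : P = (fun j => T (j - 1) + T j *m H) by apply/funext.
rewrite momentD // moment_shift /moment -fsumD.
- by apply: eq_fsbigr => j _; rewrite mulmxDr mulmxA.
- exact: finite_moment finT.
- by under eq_set do rewrite -mulmxA; exact: finite_moment finT.
Qed.

Lemma moment_window (R : realType) (D m K : nat) (M : int -> 'M[R[i]]_D)
    (u : int -> 'M[R[i]]_(D, m)) :
  (forall j : int, (K <= `|j|)%N -> M j = 0) ->
  moment M u = \sum_(i < K + K) M (i%:Z - K%:Z) *m u (i%:Z - K%:Z).
Proof.
move=> M0; pose s := [seq i%:Z - K%:Z | i <- iota 0 (K + K)].
have us : uniq s by rewrite map_inj_uniq ?iota_uniq // => i j /addIr [].
have mem_s (j : int) : (`|j| < K)%N -> j \in s.
  move=> jK; apply/mapP; exists (absz (j + K%:Z)); last by lia.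
  by rewrite mem_iota; lia.
rewrite -(big_mkord xpredT (fun i : nat => M (i%:Z - K%:Z) *m u (i%:Z - K%:Z))).
rewrite /moment (@fsbigE _ _ _ _ _ s) //.
  by rewrite big_map /index_iota subn0; apply: eq_bigl => i; rewrite in_setT.
move=> j _ js; have [jK|/mem_s js1] := leqP K (absz j).
  by rewrite M0 ?mul0mx.
by rewrite js1 in js.
Qed.

(** * Laurent coefficients and symbols *)

(** Multiplied by w^K, each entry becomes a polynomial of degree below 2K in w; it vanishes at the
    2K points 1, ..., 2K. *)
Lemma moment_pow_inj (R : realType) (D : nat) (M : int -> 'M[R[i]]_D) :
  finitely_supported M ->
  (forall w, w != 0 -> moment M (fun j => (w ^ j)%:M) = 0) ->
  forall j, M j = 0.
Proof.
move=> /finitely_supported_window[K M0] sM j.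
have [|jK] := leqP K `|j|%N; first exact: M0.
apply/matrixP => a b; rewrite mxE.
pose q := \poly_(i < K + K) M (i%:Z - K%:Z) a b.
have q0 : q = 0.
  apply: (@roots_geq_poly_eq0 _ _ [seq k.+1%:R | k <- iota 0 (K + K)]).
  - apply/allP => _ /mapP[k _ ->]; rewrite /root horner_poly.
    set w := k.+1%:R; have w0 : w != 0 by rewrite pnatr_eq0.
    have /matrixP/(_ a b) := sM w w0.
    rewrite (moment_window _ M0) summxE mxE => /(congr1 ( *%R (w ^ K%:Z))).
    rewrite mulr0 mulr_sumr => sum0; apply/eqP; rewrite -[RHS]sum0.
    apply: eq_bigr => i _; rewrite mul_mx_scalar mxE mulrA -expfzDr //.
    by rewrite subrKC mulrC.
  - rewrite map_inj_uniq ?iota_uniq // => x y /eqP.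
    by rewrite eqr_nat => /eqP [].
  - by rewrite size_map size_iota size_poly.
have := congr1 (fun q : {poly R[i]} => q`_(absz (j + K%:Z))) q0.
rewrite coef0 coef_poly ifT; last by lia.
by have -> : (absz (j + K%:Z))%:Z - K%:Z = j by lia.
Qed.

Lemma moment_pow_eq (R : realType) (D : nat) (M N : int -> 'M[R[i]]_D) :
  finitely_supported M -> finitely_supported N ->
  (forall w, w != 0 ->
     moment M (fun j => (w ^ j)%:M) = moment N (fun j => (w ^ j)%:M)) ->
  forall j, M j = N j.
Proof.
move=> finM finN MN j; apply/eqP; rewrite -subr_eq0; apply/eqP.
have finNn : finitely_supported (fun j => - N j).
  by apply: finitely_supported_sub finN => k ->; rewrite oppr0.
have finMN := finitely_supportedD finM finNn.
apply: (moment_pow_inj finMN) => w w0.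
apply: (addrI (moment N (fun j => (w ^ j)%:M))).
rewrite -momentD // addr0 -MN //; congr moment; apply/funext => k.
by rewrite addrC subrK.
Qed.

(** The reindexing by -j expands the symbol in w = z^-1, the variable in which the pencil is
    linear. *)
Lemma symbol_moment (R : realType) (D : nat) (M : int -> 'M[R[i]]_D) z :
  symbol M z = moment (fun j => M (- j)) (fun j => ((z^-1) ^ j)%:M).
Proof.
rewrite /symbol (reindex_fsbigT (fun j : int => - j)); last first.
  by exists -%R => j; rewrite opprK.
by apply: eq_fsbigr => j _; rewrite mul_mx_scalar exprz_inv.
Qed.

Lemma sharp_moment (R : realType) (D : nat) (M : int -> 'M[R[i]]_D) z :
  finitely_supported M ->
  sharp M z = moment (fun j => (M j)^T) (fun j => ((z^-1) ^ j)%:M).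
Proof.
move=> finM; rewrite /sharp /symbol raddf_fsum; last first.
  apply: sub_finite_set finM => j /=; apply: contra => /eqP ->.
  by rewrite scaler0.
by apply: eq_fsbigr => j _; rewrite mul_mx_scalar /= linearZ.
Qed.

Lemma moment_mulmxr (R : realType) (D m l : nat) (M : int -> 'M[R[i]]_D)
    (u : int -> 'M[R[i]]_(D, m)) (A : 'M[R[i]]_(m, l)) :
  finitely_supported M -> moment M u *m A = moment M (fun j => u j *m A).
Proof.
move=> finM; rewrite /moment -[LHS]/(mulmxr A _) raddf_fsum.
  by apply: eq_fsbigr => j _ /=; rewrite mulmxA.
exact: finite_moment.
Qed.

(** Summation by parts with [T j = S (- j)]: scalar matrices commute with [H], so w^(j+1) I + H w^j
    = w^j (w I + H). *)
Lemma symbol_pencil (R : realType) (D : nat) (H : 'M[R[i]]_D)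
    (S : int -> 'M[R[i]]_D) (z : R[i]) : z != 0 -> finitely_supported S ->
  symbol S z *m pencil H z =
  moment (fun j => S (1 - j) + S (- j) *m H) (fun j => ((z^-1) ^ j)%:M).
Proof.
move=> z0 finS; have finT : finitely_supported (fun j => S (- j)).
  exact: (finitely_supported_comp oppr_inj finS).
rewrite symbol_moment moment_mulmxr //.
rewrite [RHS](@moment_factor _ _ _ H _ (fun j => S (- j))) //; last first.
  by move=> j; rewrite opprB.
congr moment; apply/funext => j.
rewrite /pencil mulmxDr -scalar_mxM expfzDr ?invr_eq0 // expr1z.
by rewrite scalar_mxC.
Qed.

(** * Right division by the pencil *)

(* Horner's scheme, starting from the top coefficient [P 0]. *)
Fixpoint horner_quotient (R : realType) (D : nat) (H : 'M[R[i]]_D)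
    (P : nat -> 'M[R[i]]_D) (m : nat) : 'M[R[i]]_D :=
  if m is m'.+1 then P m' - horner_quotient H P m' *m H else 0.

(** The recurrence turns v (n - m) into - H v (n - m - 1), which is exactly one Horner update. *)
Lemma horner_quotientE (R : realType) (D : nat) (H : 'M[R[i]]_D)
    (P : nat -> 'M[R[i]]_D) (n : nat) (v : int -> 'cV[R[i]]_D) (m : nat) :
  (forall j, v (j + 1) + H *m v j = 0) ->
  \sum_(i < m) P i *m v (n%:Z - i.+1%:Z) =
  horner_quotient H P m *m v (n%:Z - m%:Z).
Proof.
move=> vH; elim: m => [|m IH]; first by rewrite big_ord0 mul0mx.
rewrite big_ord_recr /= IH mulmxBl addrC -mulmxA; congr (_ + _).
have := vH (n%:Z - m.+1%:Z); have -> : n%:Z - m.+1%:Z + 1 = n%:Z - m%:Z by lia.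
by move=> /eqP; rewrite addr_eq0 => /eqP ->; rewrite mulmxN.
Qed.

(* The remainder of the division annihilates all [v 0]; an even shift moves the
   window of indices of [P] into the nonnegative integers. *)
Lemma right_quotient (R : realType) (D : nat) (H : 'M[R[i]]_D)
    (V : set (int -> 'cV[R[i]]_D)) (P : int -> 'M[R[i]]_D) :
  (forall v, V v -> forall j, v (j + 1) + H *m v j = 0) ->
  (forall A : 'M[R[i]]_D, (forall v, V v -> A *m v 0 = 0) -> A = 0) ->
  finitely_supported P ->
  (forall v, V v -> forall k : int, moment P (fun j => v (j + 2 * k)) = 0) ->
  exists2 T : int -> 'M[R[i]]_D, finitely_supported T &
    forall j, P j = T (j - 1) + T j *m H.
Proof.
move=> VH V_full /finitely_supported_window[K P0] Pv.
have P0' (j : int) : (2 * K <= `|j|)%N -> P j = 0.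
  by move=> jK; apply: P0; lia.
pose N := (2 * K + 2 * K)%N.
(* The coefficients are read downwards from index 2K - 1; once all N of them are consumed, [q N] is
   the remainder. *)
pose q := horner_quotient H (fun m => P ((2 * K)%N%:Z - m.+1%:Z)).
have qN : q N = 0.
  (* The moment with shift 2K involves v at 0, ..., N - 1 only, so Horner's scheme ends exactly at
     [v 0]. *)
  apply: V_full => v Vv; rewrite -[RHS](Pv v Vv K%:Z) (moment_window _ P0').
  rewrite (reindex_inj rev_ord_inj) /= -[X in v X](subrr N%:Z).
  rewrite -horner_quotientE; last exact: VH.
  apply: eq_bigr => i _; have iN : (i < 2 * K + 2 * K)%N := ltn_ord i.
  rewrite /N; move: (nat_of_ord i) iN => m mN.
  by congr (P _ *m v _); lia.
(* Below the window [P] is 0, so the zero remainder propagates; this makes the quotient finitely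
   supported. *)
have q_big m : (N <= m)%N -> q m = 0.
  elim: m => [|m IH]; first by [].
  rewrite leq_eqVlt => /predU1P[<- //|]; rewrite ltnS => Nm.
  rewrite /q /= -/q -/(q m) IH // mul0mx subr0 P0' //.
  by rewrite /N in Nm; lia.
(* With m = 2K - 1 - j, the update q (m + 1) = P j - q m H reads T (j - 1) = P j - T j H. The guard
   prevents [absz] from folding back the indices j >= 2K. *)
pose T (j : int) :=
  if j < (2 * K)%N%:Z then q (absz ((2 * K)%N%:Z - 1 - j)%R) else 0.
exists T.
  apply: (@window_finitely_supported _ _ (N + 1)) => j jN; rewrite /T.
  by case: ifP => // jK; rewrite q_big // /N; rewrite /N in jN; lia.
move=> j; rewrite /T; case: ltP => j1K; case: ltP => jK.
- have -> : absz ((2 * K)%N%:Z - 1 - (j - 1))%R =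
    (absz ((2 * K)%N%:Z - 1 - j)%R).+1 by lia.
  by rewrite /q /= -/q subrK; congr P; lia.
- have -> : absz ((2 * K)%N%:Z - 1 - (j - 1))%R = 0%N by lia.
  by rewrite P0' ?mul0mx ?addr0 //; lia.
- by lia.
- by rewrite P0' ?mul0mx ?addr0 //; lia.
Qed.

(** * Derivatives of polynomials and exponentials on the real line *)

(** Componentwise to match [cderiv]; [is_derive] also asserts differentiability, which a value of
    [derive1n] alone does not. *)
Definition has_cderiv (R : realType) (f g : R -> R[i]) : Prop := forall x : R,
  is_derive x 1 (fun t => complex.Re (f t)) (complex.Re (g x)) /\
  is_derive x 1 (fun t => complex.Im (f t)) (complex.Im (g x)).

Lemma cderiv_iter (R : realType) (F : nat -> R -> R[i]) :
  (forall m, has_cderiv (F m) (F m.+1)) -> forall m, cderiv m (F 0%N) = F m.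
Proof.
move=> FS m.
suff [reE imE] : derive1n m (fun t => complex.Re (F 0%N t)) =
      (fun t => complex.Re (F m t)) /\
    derive1n m (fun t => complex.Im (F 0%N t)) = (fun t => complex.Im (F m t)).
  by apply/funext => x; rewrite /cderiv reE imE; case: (F m x).
elim: m => [|m [IHr IHi]]; first by rewrite !derive1n0.
rewrite !derive1nS IHr IHi; split; apply/funext => x; rewrite derive1E.
  by have [? _] := FS m x; rewrite derive_val.
by have [_ ?] := FS m x; rewrite derive_val.
Qed.

Lemma ReD (R : realType) (a b : R[i]) :
  complex.Re (a + b) = complex.Re a + complex.Re b.
Proof. by case: a b => [? ?] []. Qed.

Lemma ImD (R : realType) (a b : R[i]) :
  complex.Im (a + b) = complex.Im a + complex.Im b.
Proof. by case: a b => [? ?] []. Qed.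

Lemma ReM (R : realType) (a b : R[i]) : complex.Re (a * b) =
  complex.Re a * complex.Re b - complex.Im a * complex.Im b.
Proof. by case: a b => [? ?] []. Qed.

Lemma ImM (R : realType) (a b : R[i]) : complex.Im (a * b) =
  complex.Re a * complex.Im b + complex.Im a * complex.Re b.
Proof. by case: a b => [? ?] []. Qed.

Lemma has_cderiv_cst (R : realType) (c : R[i]) :
  has_cderiv (fun=> c) (fun=> 0).
Proof. by move=> x; split; exact: is_derive_cst. Qed.

Lemma has_cderiv_id (R : realType) :
  has_cderiv (fun t : R => t%:C) (fun=> 1).
Proof. by move=> x; split; [exact: is_derive_id|exact: is_derive_cst]. Qed.

Lemma has_cderivD (R : realType) (f g f' g' : R -> R[i]) :
  has_cderiv f f' -> has_cderiv g g' ->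
  has_cderiv (fun t => f t + g t) (fun t => f' t + g' t).
Proof.
move=> df dg x; have [df1 df2] := df x; have [dg1 dg2] := dg x; split.
  under eq_fun do rewrite ReD.
  by rewrite ReD; exact: is_deriveD.
under eq_fun do rewrite ImD.
by rewrite ImD; exact: is_deriveD.
Qed.

Lemma has_cderivM (R : realType) (f g f' g' : R -> R[i]) :
  has_cderiv f f' -> has_cderiv g g' ->
  has_cderiv (fun t => f t * g t) (fun t => f' t * g t + f t * g' t).
Proof.
move=> df dg x; have [df1 df2] := df x; have [dg1 dg2] := dg x; split.
  under eq_fun do rewrite ReM.
  apply: is_derive_eq.
  by rewrite ReD !ReM /GRing.scale /=; ring.
under eq_fun do rewrite ImM.
apply: is_derive_eq.
by rewrite ImD !ImM /GRing.scale /=; ring.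
Qed.

Lemma has_cderiv_sum (R : realType) (I : Type) (s : seq I)
    (f g : I -> R -> R[i]) : (forall i, has_cderiv (f i) (g i)) ->
  has_cderiv (fun t => \sum_(i <- s) f i t) (fun t => \sum_(i <- s) g i t).
Proof.
move=> fg; elim: s => [|i s IH].
  have := @has_cderiv_cst R 0.
  by congr has_cderiv; apply/funext => t; rewrite big_nil.
have := has_cderivD (fg i) IH.
by congr has_cderiv; apply/funext => t; rewrite big_cons.
Qed.

Lemma has_cderiv_horner (R : realType) (q : {poly R[i]}) :
  has_cderiv (fun t => q.[t%:C]) (fun t => q^`().[t%:C]).
Proof.
elim/poly_ind: q => [|q c IH].
  have := @has_cderiv_cst R 0.
  by congr has_cderiv; apply/funext => t; rewrite ?deriv0 horner0.
have := has_cderivD (has_cderivM IH (@has_cderiv_id R)) (has_cderiv_cst c).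
congr has_cderiv; apply/funext => t; rewrite !hornerE //.
by rewrite derivD derivM derivX derivC !hornerE.
Qed.

(** For mu = a + ib the two parts are e^(at) cos(bt) and e^(at) sin(bt), handled by the real product
    and chain rules. *)
Lemma has_cderiv_cexp (R : realType) (mu : R[i]) :
  has_cderiv (fun t => cexp (mu * t%:C)) (fun t => mu * cexp (mu * t%:C)).
Proof.
case: mu => a b x; rewrite /cexp.
have lin (c : R) : is_derive x 1 (fun t : R => c * t) c.
  by apply: is_derive_eq; rewrite /GRing.scale /=; ring.
have argE t : (a +i* b) * t%:C = (a * t) +i* (b * t).
  by apply/eqP; rewrite eq_complex /=; apply/andP; split; apply/eqP; ring.
have dexp : is_derive x 1 (fun t => expR (a * t)) (expR (a * x) * a).
  exact: (is_derive1_comp (f := expR)).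
have dcos : is_derive x 1 (fun t => cos (b * t)) (- sin (b * x) * b).
  exact: (is_derive1_comp (f := cos)).
have dsin : is_derive x 1 (fun t => sin (b * t)) (cos (b * x) * b).
  exact: (is_derive1_comp (f := sin)).
split; under eq_fun do rewrite argE /=; rewrite argE /=.
  by apply: is_derive_eq; rewrite /GRing.scale /=; ring.
by apply: is_derive_eq; rewrite /GRing.scale /=; ring.
Qed.

Lemma cexpD (R : realType) (x y : R[i]) : cexp (x + y) = cexp x * cexp y.
Proof.
rewrite /cexp ReD ImD expRD cosD sinD; apply/eqP; rewrite eq_complex ReM ImM /=.
by apply/andP; split; apply/eqP; ring.
Qed.

Lemma cexp0 (R : realType) : cexp (0 : R[i]) = 1.
Proof.
by rewrite /cexp /= expR0 cos0 sin0 !mul1r.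
Qed.

(** This evaluates the term z^-1 of the pencil at z = cexp (- mu). *)
Lemma cexpNV (R : realType) (x : R[i]) : (cexp (- x))^-1 = cexp x.
Proof.
by apply: mulr1_eq; rewrite -cexpD addNr cexp0.
Qed.

(** * Samples of the functions in V *)

(** A formal polynomial gives access to formal derivatives and Taylor expansion; the degree bound is
    kept separate. *)
Definition expoly (R : realType) (r : nat) (lam : 'I_r -> R[i])
    (q : {poly R[i]}) (b : bool * 'I_r -> R[i]) (x : R) : R[i] :=
  q.[x%:C] + \sum_si b si * cexp (sfreq lam si * x%:C).

Lemma Vspace_expoly (R : realType) (p r : nat) (lam : 'I_r -> R[i])
    (f : R -> R[i]) : Vspace p lam f <->
  exists (q : {poly R[i]}) b, (size q <= p.+1)%N /\ f = expoly lam q b.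
Proof.
split=> [[a [b fE]]|[q [b [sq ->]]]].
  exists (\poly_(j < p.+1) a (inord j)), b; split; first exact: size_poly.
  apply/funext => x; rewrite fE /expoly horner_poly; congr (_ + _).
  by apply: eq_bigr => j _; rewrite inord_val rmorphXn.
exists (fun j => q`_j), b => x; rewrite /expoly (horner_coef_wide _ sq).
by congr (_ + _); apply: eq_bigr => j _; rewrite rmorphXn.
Qed.

Lemma cderiv_expoly (R : realType) (r : nat) (lam : 'I_r -> R[i])
    (q : {poly R[i]}) (b : bool * 'I_r -> R[i]) (m : nat) :
  cderiv m (expoly lam q b) =
  expoly lam q^`(m) (fun si => b si * sfreq lam si ^+ m).
Proof.
pose F m := expoly lam q^`(m) (fun si => b si * sfreq lam si ^+ m).
have -> : expoly lam q b = F 0%N.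
  apply/funext => x; congr (_ + _); apply: eq_bigr => si _.
  by rewrite expr0 mulr1.
apply: cderiv_iter => {}m; rewrite /F /expoly derivnS.
apply: has_cderivD; first exact: has_cderiv_horner.
apply: has_cderiv_sum => si.
have := has_cderivM (has_cderiv_cst (b si * sfreq lam si ^+ m))
  (has_cderiv_cexp (sfreq lam si)).
by congr has_cderiv; apply/funext => t; rewrite mul0r add0r exprSr !mulrA.
Qed.

Lemma sfreqZ (R : realType) (r : nat) (lam : 'I_r -> R[i]) (c : R[i])
    (si : bool * 'I_r) : sfreq (fun i => c * lam i) si = c * sfreq lam si.
Proof. by rewrite /sfreq mulrCA. Qed.

Lemma admissibleZ (R : realType) (r : nat) (lam : 'I_r -> R[i]) (c : R[i]) :
  c != 0 -> admissible lam -> admissible (fun i => c * lam i).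
Proof.
move=> c0 [lam0 laminj]; split=> [si|si sj].
  by rewrite sfreqZ mulf_neq0.
by rewrite !sfreqZ => /(mulfI c0) /laminj.
Qed.

Definition polysample (R : realType) (D : nat) (h : R[i]) (q : {poly R[i]})
    (x : R[i]) : 'cV[R[i]]_D := \col_m (h ^+ m * q^`(m).[x]).

(** Since h^m s^m = (h s)^m and s (h k) = (h s) k, sampling with step h = 2^-n rescales the
    frequencies by 2^-n. *)
Lemma sample_expoly (R : realType) (D r : nat) (lam : 'I_r -> R[i])
    (q : {poly R[i]}) (b : bool * 'I_r -> R[i]) (n : nat) (k : int) :
  let h := (2 ^- n : R)%:C in
  let mu := sfreq (fun i => h * lam i) in
  sample D (expoly lam q b) n k =
  polysample D h q (h * (k%:~R)%:C) +
  \sum_si (b si * cexp (mu si * (k%:~R)%:C)) *: freqvec D (mu si).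
Proof.
move=> h mu; apply/matrixP => m j; rewrite !mxE cderiv_expoly /expoly.
rewrite mulrDr rmorphM rmorphXn /= -/h summxE; congr (_ + _).
rewrite mulr_sumr; apply: eq_bigr => si _; rewrite !mxE /mu sfreqZ.
set s := sfreq lam si.
rewrite [(h * s) ^+ m]exprMn -[h * _ * _]mulrA [h * (_ * _)]mulrCA.
by ring.
Qed.

(** Matches the Taylor coefficients of the i-th derivative with the factorials in the entries of
    [Tmx]. *)
Lemma nderivn_derivn (F : numFieldType) (q : {poly F}) (i s : nat) :
  q^`(i)^`N(s) = (s`!%:R)^-1 *: q^`(i + s).
Proof.
have s0 : (s`!%:R : F) != 0 by rewrite pnatr_eq0 -lt0n fact_gt0.
apply: (scalerI s0); rewrite scalerA divff // scale1r scaler_nat.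
by rewrite -nderivn_def addnC /derivn iterD.
Qed.

Lemma size_derivn (A : nzRingType) (q : {poly A}) (n m : nat) :
  (size q <= n)%N -> (size q^`(m) <= n - m)%N.
Proof.
move=> sq; apply/leq_sizeP => j jn; rewrite coef_derivn nth_default ?mul0rn //.
by apply: leq_trans sq _; rewrite -leq_subLR.
Qed.

(* The (i, l) entry of 1 - Tmx p 1 is 1 / (l - i)! for i <= l and 0 otherwise:
   row i is Taylor's formula for the i-th derivative of q. *)
Lemma polysample_recursion (R : realType) (p : nat) (h x : R[i])
    (q : {poly R[i]}) : (size q <= p.+1)%N ->
  polysample p.+1 h q (x + h) + (Tmx p 1 - 1%:M) *m polysample p.+1 h q x = 0.
Proof.
move=> sq; apply/matrixP => i j.
rewrite mxE [X in X + _]mxE [X in _ + X]mxE [RHS]mxE.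
rewrite (nderiv_taylor_wide (mulrC _ _) (size_derivn i sq)).
rewrite mulr_sumr -(big_mkord xpredT
  (fun s => h ^+ i * (q^`(i)^`N(s).[x] * h ^+ s))).
have E (l : 'I_p.+1) : (Tmx p 1 - 1%:M) i l * polysample p.+1 h q x l j =
    if (i <= l)%N then - (h ^+ l * q^`(i)^`N(l - i).[x]) else 0.
  rewrite !mxE; case: ltngtP => [il|li|/val_inj <-].
  - rewrite nderivn_derivn hornerZ subnKC 1?ltnW //.
    case: eqP => [ile|_]; first by rewrite ile ltnn in il.
    by rewrite subr0 mulNr; congr (- _); rewrite mulrCA.
  - case: eqP => [ile|_]; first by rewrite ile ltnn in li.
    by rewrite subr0 mul0r.
  - by rewrite eqxx invr1 subrr sub0r mulN1r subnn nderivn0.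
rewrite (eq_bigr _ (fun l _ => E l)).
(* Only l >= i contributes; l = s + i leaves p + 1 - i terms, as many as in the Taylor expansion. *)
pose G (l : nat) := h ^+ l * q^`(i)^`N(l - i).[x].
rewrite -big_mkcond sumrN /= -[X in _ - X](big_mkord (fun l => (i <= l)%N) G).
rewrite -(@big_nat_widenl _ _ _ i 0 p.+1 xpredT) //.
rewrite [X in _ - X](big_addn 0 p.+1 i xpredT G).
apply/eqP; rewrite subr_eq0; apply/eqP/eq_bigr => s _.
by rewrite /G addnK exprD; ring.
Qed.

(** Derivatives of order above p vanish, so only the left block column of the pencil acts on
    polynomial samples. *)
Lemma polysample_col (R : realType) (p d : nat) (h x : R[i])
    (q : {poly R[i]}) : (size q <= p.+1)%N ->
  polysample (p.+1 + d) h q x = col_mx (polysample p.+1 h q x) 0.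
Proof.
move=> sq; rewrite -[LHS]vsubmxK; congr col_mx; apply/matrixP => i j.
  by rewrite !mxE.
rewrite !mxE derivn_poly0 ?horner0 ?mulr0 //.
by rewrite (leq_trans sq) //= leq_addr.
Qed.

Lemma cancellation_sample (R : realType) (p r : nat) (lam : 'I_r -> R[i])
    (n : nat) (H : 'M[R[i]]_(p.+1 + 2 * r)) (f : R -> R[i]) (k : int) :
  is_cancellation (fun i => (2 ^- n)%:C * lam i) H -> Vspace p lam f ->
  sample (p.+1 + 2 * r) f n (k + 1) + H *m sample (p.+1 + 2 * r) f n k = 0.
Proof.
move=> [Hul Hexp] /Vspace_expoly[q [b [sq ->]]].
rewrite !sample_expoly; set h := (2 ^- n)%:C in Hul Hexp *.
set mu := sfreq _ in Hexp *.
(* Each [freqvec] is an eigenvector of [H] with eigenvalue - cexp mu, which cancels the factor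
   gained from k to k + 1. *)
have Hfreq si : H *m freqvec _ (mu si) = - (cexp (mu si) *: freqvec _ (mu si)).
  apply/eqP; rewrite -addr_eq0; apply/eqP; rewrite -[RHS](Hexp si) /pencil.
  by rewrite mulmxDl mul_scalar_mx cexpNV addrC.
have kE : ((k + 1)%:~R)%:C = (k%:~R)%:C + 1 :> R[i].
  by rewrite rmorphD /= rmorph1 rmorphD rmorph1.
(* Polynomial and exponential parts cancel separately; the exponentials come first. *)
rewrite mulmxDr addrACA [X in X + _](_ : _ = 0) ?add0r.
  rewrite mulmx_sumr -big_split big1 //= => si _.
  rewrite -scalemxAr Hfreq scalerN scalerA -scalerBl.
  by rewrite kE mulrDr mulr1 cexpD mulrA subrr scale0r.
rewrite kE mulrDr mulr1 !polysample_col //.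
(* The block structure is given for the pencil; its value at z = 1 carries it over to [H]. *)
have HE : H = pencil H 1 - 1%:M by rewrite /pencil invr1 addrC addKr.
have [Hul1 Hdl1] := Hul 1 (oner_neq0 _).
rewrite {1}HE -[pencil H 1]submxK Hul1 Hdl1 mulmxBl mul_block_col mul_scalar_mx.
rewrite scale1r !mulmx0 !mul0mx !addr0 opp_col_mx !add_col_mx oppr0 !addr0.
rewrite -[X in _ *m X - X]/(polysample p.+1 h q (h * (k%:~R)%:C)).
rewrite -{2}[polysample p.+1 h q (h * _)]mul1mx -mulmxBl.
by rewrite polysample_recursion // col_mx0.
Qed.

(** Read as polynomials of degree at most p + 2r, the rows of [A] are divisible by X^(p+1) and
    vanish at 2r distinct nonzero frequencies, hence are 0. *)
Lemma sample0_full (R : realType) (p r : nat) (lam : 'I_r -> R[i]) (n : nat)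
    (A : 'M[R[i]]_(p.+1 + 2 * r)) :
  admissible lam ->
  (forall f, Vspace p lam f -> A *m sample (p.+1 + 2 * r) f n 0 = 0) -> A = 0.
Proof.
move=> hlam AV; set D := (p.+1 + 2 * r)%N in A AV *.
have h0 : (2 ^- n)%:C != 0 :> R[i].
  by rewrite fmorph_eq0 invr_eq0 expf_neq0 // pnatr_eq0.
have [mu0 mu_inj] := admissibleZ h0 hlam.
set h := (2 ^- n)%:C in h0 mu0 mu_inj; set mu := sfreq _ in mu0 mu_inj.
have Aq (q : {poly R[i]}) : (size q <= p.+1)%N -> A *m polysample D h q 0 = 0.
  move=> sq; rewrite -[RHS](AV (expoly lam q (fun=> 0))); last first.
    by apply/Vspace_expoly; exists q, (fun=> 0).
  rewrite sample_expoly big1 ?addr0; last by move=> si _; rewrite mul0r scale0r.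
  by rewrite mulr0.
have Amu si : A *m freqvec D (mu si) = 0.
  rewrite -[RHS](AV (expoly lam 0 (fun s => (s == si)%:R))); last first.
    apply/Vspace_expoly; exists 0, (fun s => (s == si)%:R).
    by rewrite size_poly0.
  rewrite sample_expoly (bigD1 si) //= eqxx mul1r !mulr0 cexp0 scale1r.
  rewrite big1 ?addr0; last by move=> s /negPf ->; rewrite mul0r scale0r.
  rewrite [polysample _ _ _ _](_ : _ = 0) ?add0r //.
  apply/matrixP => a b.
  by rewrite !mxE derivn_poly0 ?size_poly0 // horner0 mulr0.
(* At 0 the monomial X^m samples to h^m m! times the m-th unit vector. *)
have Alow a (m : 'I_p.+1) : A a (lshift _ m) = 0.
  have sX : (size ('X^m : {poly R[i]}) <= p.+1)%N by rewrite size_polyXn.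
  have /matrixP/(_ a 0) := Aq _ sX; rewrite !mxE (bigD1 (lshift _ m)) //=.
  rewrite big1 ?addr0.
    rewrite !mxE derivnXn subnn ffactnn expr0 hornerMn hornerC => /eqP.
    rewrite mulf_eq0 mulf_eq0 expf_eq0 (negPf h0) andbF pnatr_eq0.
    by rewrite eqn0Ngt fact_gt0 orbF => /eqP.
  move=> l lm; rewrite !mxE derivnXn hornerMn hornerXn.
  have lm' : nat_of_ord l != m.
    by apply: contra lm => /eqP lm; apply/eqP/val_inj.
  have [ml|lem] := ltnP m l; first by rewrite ffact_small // mulr0n !mulr0.
  by rewrite expr0n subn_eq0 leqNgt ltn_neqAle lm' lem mul0rn !mulr0.
apply/row_matrixP => a; rewrite row0.
pose P := rVpoly (row a A).
have P_low : take_poly p.+1 P = 0.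
  apply/polyP => l; rewrite coef_take_poly coef0; case: ifP => // lp.
  rewrite -[RHS](Alow a (Ordinal lp)).
  by have := coef_rVpoly_ord (row a A) (lshift _ (Ordinal lp)); rewrite mxE.
(* [Q] has size at most 2r and inherits the 2r roots, since these are nonzero. *)
pose Q := drop_poly p.+1 P.
have PE : P = Q * 'X^(p.+1).
  by rewrite -[LHS](poly_take_drop p.+1) P_low add0r.
have Q0 : Q = 0.
  apply: (@roots_geq_poly_eq0 _ _ [seq mu si | si <- enum {: bool * 'I_r}]).
  - apply/allP => _ /mapP[si _ ->].
    have : P.[mu si] = 0.
      rewrite (horner_coef_wide _ (size_poly _ _)).
      have /matrixP/(_ a 0) := Amu si; rewrite !mxE => sum0; rewrite -[RHS]sum0.
      by apply: eq_bigr => l _; rewrite coef_rVpoly_ord !mxE.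
    rewrite PE hornerM hornerXn => /eqP; rewrite mulf_eq0 expf_eq0.
    by rewrite (negPf (mu0 si)) andbF orbF.
  - by rewrite map_inj_uniq ?enum_uniq.
  - rewrite size_map -cardE card_prod card_bool card_ord.
    by rewrite size_drop_poly leq_subLR size_poly.
by rewrite -[LHS]rVpolyK -/P PE Q0 mul0r linear0.
Qed.

(** * Vanishing moments and the factorization *)

(** Here [P] stands for the transposed coefficients at a single level; the second condition is the
    factorization read on coefficients of w = z^-1. *)
Lemma moment_cancellation (R : realType) (p r : nat) (lam : 'I_r -> R[i])
    (n : nat) (H : 'M[R[i]]_(p.+1 + 2 * r))
    (P : int -> 'M[R[i]]_(p.+1 + 2 * r)) :
  admissible lam -> is_cancellation (fun i => (2 ^- n)%:C * lam i) H ->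
  finitely_supported P ->
  (forall f, Vspace p lam f -> forall k : int,
     moment P (fun j => sample (p.+1 + 2 * r) f n (j + 2 * k)) = 0) <->
  exists2 T : int -> 'M[R[i]]_(p.+1 + 2 * r), finitely_supported T &
    forall j, P j = T (j - 1) + T j *m H.
Proof.
move=> hlam hH finP; split=> [PV|[T finT PE] f Vf k]; last first.
  (* Summation by parts leaves [T j] times an expression that the recurrence of the samples makes
     0. *)
  rewrite (moment_factor _ finT PE) /moment fsbig1 // => j _.
  by rewrite addrAC (cancellation_sample _ hH Vf) mulmx0.
pose V := [set sample (p.+1 + 2 * r) f n | f in Vspace p lam].
apply: (right_quotient (V := V)).
- by move=> _ [f Vf <-] j; exact: cancellation_sample hH Vf.
- by move=> A AV; apply: sample0_full hlam _ => f Vf; apply: AV; exists f.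
- exact: finP.
- by move=> _ [f Vf <-] k; exact: PV.
Qed.

Theorem proposition4 (R : realType) (p r : nat) (lam : 'I_r -> R[i])
  (hlam : admissible lam)
  (B : nat -> int -> 'M[R[i]]_(p.+1 + 2 * r))
  (hB : forall n : nat, finitely_supported (B n)) :
  (forall (f : R -> R[i]), Vspace p lam f -> forall (k : int) (n : nat),
     \sum_(j \in [set: int])
       (B n (j - 2 * k))^T *m sample (p.+1 + 2 * r) f n.+1 j = 0)
  <->
  (forall n : nat, exists S : int -> 'M[R[i]]_(p.+1 + 2 * r),
     finitely_supported S /\
     forall z : R[i], z != 0 ->
       sharp (B n) z = symbol S z *m Hlevel p lam n.+1 z).
Proof.
have finBT n : finitely_supported (fun j => (B n j)^T).
  by apply: finitely_supported_sub (hB n) => j ->; rewrite trmx0.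
(* The levels are independent of each other, so the equivalence is proved for each n. *)
have level n : (forall (f : R -> R[i]), Vspace p lam f -> forall k : int,
    moment (fun j => (B n j)^T)
      (fun j => sample (p.+1 + 2 * r) f n.+1 (j + 2 * k)) = 0) <->
  exists S : int -> 'M[R[i]]_(p.+1 + 2 * r), finitely_supported S /\
    forall z : R[i], z != 0 ->
      sharp (B n) z = symbol S z *m Hlevel p lam n.+1 z.
  have h0 : (2 ^- n.+1)%:C != 0 :> R[i].
    by rewrite fmorph_eq0 invr_eq0 expf_neq0 // pnatr_eq0.
  have [H hH HE] := Hstar_cancellation p (admissibleZ h0 hlam).
  rewrite (moment_cancellation hlam hH (finBT n)); split.
    (* The indices are reversed because [S] is expanded in z and [T] in z^-1. *)
    move=> [T finT BE]; exists (fun j => T (- j)); split.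
      exact: (finitely_supported_comp oppr_inj finT).
    move=> z z0; rewrite /Hlevel HE symbol_pencil //; last first.
      exact: (finitely_supported_comp oppr_inj finT).
    rewrite sharp_moment //; congr moment; apply/funext => j.
    by rewrite BE opprB opprK.
  move=> [S [finS SE]]; exists (fun j => S (- j)).
    exact: (finitely_supported_comp oppr_inj finS).
  move=> j; rewrite opprB.
  (* The second sequence holds the coefficients of the product in powers of w; the factorization at
     z = w^-1 gives equal values, hence equal coefficients. *)
  apply: (moment_pow_eq (finBT n) (N := fun j => S (1 - j) + S (- j) *m H)).
    apply: finitely_supportedD.
      apply: (finitely_supported_comp (h := fun j : int => 1 - j)) finS.
      by move=> x y /addrI /oppr_inj.
    apply: finitely_supported_sub (finitely_supported_comp oppr_inj finS).
    by move=> k /= ->; rewrite mul0mx.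
  move=> w w0; have wV0 : w^-1 != 0 by rewrite invr_eq0.
  have := SE _ wV0; rewrite /Hlevel HE sharp_moment // symbol_pencil //.
  by rewrite invrK.
split=> [BV n|BS f Vf k n].
  (* The shift by 2k passes from the samples to the index of [B]. *)
  apply/level => f Vf k; rewrite -moment_shift.
  exact: BV.
have := (level n).2 (BS n) f Vf k; rewrite -moment_shift.
by [].
Qed.
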